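(* Let $(P,\omega,\mathcal J,\mathfrak s)$ be an almost Kähler manifold on which an Abelian Lie group $G$ acts freely and properly by automorphisms of the almost Kähler structure, with equivariant momentum map $J:P\to U=J(P)\subset\mathfrak g^*$. Let $D$ be the connection on the symplectic stratification of $P/G$ determined by the abstract mechanical connection. Then the horizontal two-form $\omega'$ on $P/G$ coincides with the assembled two-form $\omega_D$ on $P/G$: $$\omega'=\omega_D .$$
   Context: Almost Kähler: $\omega$ is a symplectic form, $\mathcal J$ an almost complex structure ($\mathcal J^2=-1$), $\mathfrak s$ a $\mathcal J$-invariant Riemannian metric, with $\omega(v,w)=\mathfrak s(\mathcal Jv,w)$. $G$ preserves $\omega,\mathcal J,\mathfrak s$. $\xi_P$ is the infinitesimal generator of $\xi\in\mathfrak g$, and $\omega(\xi_P,\cdot)=d\langle J,\xi\rangle$. $\pi:P\to P/G$ is the projection; $\pi$ and $J$ are surjective submersions. Since $G$ is Abelian, $J=j\circ\pi$ with a submersion $j:P/G\to U$; the fibers $P_\mu=j^{-1}(\mu)\cong J^{-1}(\mu)/G$ are assumed connected, and are the symplectic leaves of $P/G$, with Marsden–Weinstein reduced symplectic forms $\omega_\mu$. $E=\operatorname{Ker}Tj$ is the characteristic distribution. $W^\omega$ is the $\omega$-orthogonal complement. Abstract mechanical connection: the principal connection on $P\to P/G$ with horizontal spaces $\operatorname{hor}(x)=(\operatorname{Ker}T_x\pi)^\perp=\{v\in T_xP:\mathfrak s(v,\xi_P(x))=0\ \forall\xi\in\mathfrak g\}$. The corresponding reconstruction connection is $A(x)=\operatorname{hor}(x)\cap\operatorname{Ker}T_xJ$,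 and $D(y)=T_x\pi(A(x)^\omega)$ for $x\in\pi^{-1}(y)$; $D$ satisfies $T(P/G)=E\oplus D$. Two-form $\omega'$: for $u,v\in T_y(P/G)$, $\omega'(y)(u,v)=\omega(x)(\tilde u,\tilde v)$, where $x\in\pi^{-1}(y)$ and $\tilde u,\tilde v\in\operatorname{hor}(x)$ satisfy $T_x\pi(\tilde u)=u$, $T_x\pi(\tilde v)=v$ (independent of $x$ by $G$-invariance). Two-form $\omega_D$: $\omega_D(u,v)=\omega_\mu(p_Du,p_Dv)$ for $u,v\in T_y(P/G)$, $\mu=j(y)$, where $p_D:T(P/G)=E\oplus D\to E$ is the projection along $D$. *)

(* Defs.v *)
From HB Require Import structures.
From mathcomp Require Import all_boot all_order all_algebra.
From mathcomp Require Import all_classical all_reals all_analysis.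
Set Implicit Arguments.
Unset Strict Implicit.
Unset Printing Implicit Defensive.
Import Order.TTheory GRing.Theory Num.Theory.
Import numFieldNormedType.Exports.
Local Open Scope classical_set_scope.
Local Open Scope ring_scope.

Section Smooth.
Context {R : realType} {V W : normedModType R}.

(* Meant for open A and finite-dimensional V, where asking all directional
   derivatives to be C^k is the same as asking the total derivative to be. *)
Fixpoint Ck (k : nat) (A : set V) (f : V -> W) : Prop :=
  if k is k'.+1 then
    (forall x, A x -> differentiable f x) /\
    (forall v, Ck k' A (fun x => 'D_v f x))
  else forall x, A x -> {for x, continuous f}.

Definition smooth_on (A : set V) (f : V -> W) : Prop := forall k, Ck k A f.

End Smooth.

(* A homeomorphism from the open set cdom of M onto the open set cimg of R^n;
   the values of cmap and cinv outside these sets are irrelevant. *)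
Record chart (R : realType) (M : topologicalType) (n : nat) := Chart {
  cdom : set M;
  cimg : set 'rV[R]_n;
  cmap : M -> 'rV[R]_n;
  cinv : 'rV[R]_n -> M;
  cdom_open : open cdom;
  cimg_open : open cimg;
  cmap_img : forall x, cdom x -> cimg (cmap x);
  cinv_dom : forall p, cimg p -> cdom (cinv p);
  cmapK : forall x, cdom x -> cinv (cmap x) = x;
  cinvK : forall p, cimg p -> cmap (cinv p) = p;
  cmap_continuous : forall x, cdom x -> {for x, continuous cmap};
  cinv_continuous : forall p, cimg p -> {for p, continuous cinv} }.

(* The preferred chart chart_at x only serves to name tangent vectors: T_x M is
   R^n, a vector standing for the tangent vector at x which has it as
   coordinates in chart_at x. *)
Record manifold (R : realType) (n : nat) := Manifold {
  mtop :> topologicalType;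
  atlas : set (chart R mtop n);
  chart_at : mtop -> chart R mtop n;
  chart_at_atlas : forall x, atlas (chart_at x);
  chart_at_dom : forall x, cdom (chart_at x) x;
  atlas_compat : forall c d, atlas c -> atlas d ->
    smooth_on (cimg c `&` cinv c @^-1` cdom d) (cmap d \o cinv c);
  manifold_hausdorff : hausdorff_space mtop;
  manifold_second_countable : @second_countable mtop }.

Section Maps.
Context {R : realType} {k m n : nat}.

Definition smooth_map (M : manifold R m) (N : manifold R n) (f : M -> N) :=
  continuous f /\
  forall c d, atlas c -> atlas d ->
    smooth_on (cimg c `&` (f \o cinv c) @^-1` cdom d)
              (cmap d \o f \o cinv c).

(* Smoothness of f as a map on the product manifold M x N. *)
Definition smooth_map2 (M : manifold R m) (N : manifold R n)
    (L : manifold R k) (f : M -> N -> L) :=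
  continuous (fun p : M * N => f p.1 p.2) /\
  forall c d e, atlas c -> atlas d -> atlas e ->
    smooth_on
      [set p : 'rV[R]_m * 'rV[R]_n | [/\ cimg c p.1, cimg d p.2 &
         cdom e (f (cinv c p.1) (cinv d p.2))]]
      (fun p => cmap e (f (cinv c p.1) (cinv d p.2))).

Definition smooth_fun (W : normedModType R) (M : manifold R m) (f : M -> W) :=
  forall c, atlas c -> smooth_on (cimg c) (f \o cinv c).

(* T_x f : T_x M -> T_(f x) N *)
Definition tangent_map (M : manifold R m) (N : manifold R n) (f : M -> N)
    (x : M) : 'rV[R]_m -> 'rV[R]_n :=
  'd (cmap (chart_at (f x)) \o f \o cinv (chart_at x)) (cmap (chart_at x) x).

(* T_x f : T_x M -> W for f with values in a normed space W *)
Definition tangent_fun (W : normedModType R) (M : manifold R m) (f : M -> W)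
    (x : M) : 'rV[R]_m -> W :=
  'd (f \o cinv (chart_at x)) (cmap (chart_at x) x).

Definition surjective_map (A B : Type) (f : A -> B) : Prop :=
  forall y, exists x, f x = y.

Definition submersion (M : manifold R m) (N : manifold R n) (f : M -> N) :=
  smooth_map f /\ forall x, surjective_map (tangent_map f x).

Definition submersion_fun (W : normedModType R) (M : manifold R m)
    (f : M -> W) :=
  smooth_fun f /\ forall x, surjective_map (tangent_fun f x).

End Maps.

Section Tensors.
Context {R : realType} {n : nat}.
Implicit Type M : manifold R n.

Definition tensor2 M := M -> 'rV[R]_n -> 'rV[R]_n -> R.
Definition endomorphism_field M := M -> 'rV[R]_n -> 'rV[R]_n.

(* T_p (c^-1), with values in the tangent space at c^-1 p *)
Definition chart_frame M (c : chart R M n) (p : 'rV[R]_n) :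
    'rV[R]_n -> 'rV[R]_n :=
  'd (cmap (chart_at (cinv c p)) \o cinv c) p.

Definition tensor2_in_chart M (t : tensor2 M) (c : chart R M n)
    (u v : 'rV[R]_n) : 'rV[R]_n -> R :=
  fun p => t (cinv c p) (chart_frame c p u) (chart_frame c p v).

Definition smooth_tensor2 M (t : tensor2 M) :=
  (forall x v, linear (t x ^~ v : _ -> R^o)) /\
  (forall x u, linear (t x u : _ -> R^o)) /\
  forall c u v, atlas c -> smooth_on (cimg c) (tensor2_in_chart t c u v : _ -> R^o).

(* d t = 0, by the formula for the exterior derivative on the coordinate
   (hence commuting) vector fields with constant coefficients u, v, w. *)
Definition closed_form M (t : tensor2 M) :=
  forall c p u v w, atlas c -> cimg c p ->
    'D_u (tensor2_in_chart t c v w : _ -> R^o) p +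
    'D_v (tensor2_in_chart t c w u : _ -> R^o) p +
    'D_w (tensor2_in_chart t c u v : _ -> R^o) p = 0.

Definition symplectic_form M (omega : tensor2 M) :=
  [/\ smooth_tensor2 omega,
      forall x v, omega x v v = 0,
      forall x u, (forall v, omega x u v = 0) -> u = 0 &
      closed_form omega].

Definition riemannian_metric M (s : tensor2 M) :=
  [/\ smooth_tensor2 s,
      forall x u v, s x u v = s x v u &
      forall x v, v != 0 -> 0 < s x v v].

Definition almost_complex_structure M (I : endomorphism_field M) :=
  [/\ forall x, linear (I x),
      forall c v, atlas c ->
        smooth_on (cimg c) (fun p =>
          tangent_fun (cmap c) (cinv c p) (I (cinv c p) (chart_frame c p v))) &
      forall x v, I x (I x v) = - v].

Definition almost_kahler M (omega : tensor2 M) (I : endomorphism_field M)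
    (s : tensor2 M) :=
  [/\ symplectic_form omega,
      almost_complex_structure I,
      riemannian_metric s,
      forall x u v, s x (I x u) (I x v) = s x u v &
      forall x v w, omega x v w = s x (I x v) w].

End Tensors.

Record lie_group (R : realType) (m : nat) := LieGroup {
  lie_manifold :> manifold R m;
  lmul : lie_manifold -> lie_manifold -> lie_manifold;
  lone : lie_manifold;
  linv : lie_manifold -> lie_manifold;
  lmulA : forall a b c, lmul a (lmul b c) = lmul (lmul a b) c;
  lmul1 : forall a, lmul lone a = a;
  lmulV : forall a, lmul (linv a) a = lone;
  lmul_smooth : smooth_map2 lmul;
  linv_smooth : smooth_map linv }.

Section Actions.
Context {R : realType} {m n : nat}.
Variables (G : lie_group R m) (P : manifold R n) (act : G -> P -> P).

Definition abelian_lie_group := forall a b : G, lmul a b = lmul b a.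

(* The Lie algebra of G is T_1 G = 'rV_m, and its dual is 'cV_m. *)
Definition pairing (mu : 'cV[R]_m) (xi : 'rV[R]_m) : R := (xi *m mu) 0 0.

Definition Ad (g : G) : 'rV[R]_m -> 'rV[R]_m :=
  tangent_map (fun h : G => lmul (lmul g h) (linv g)) (lone G).

Definition smooth_action :=
  [/\ smooth_map2 act,
      forall x, act (lone G) x = x &
      forall a b x, act (lmul a b) x = act a (act b x)].

Definition free_action := forall g x, act g x = x -> g = lone G.

Definition proper_action :=
  forall K : set (P * P), compact K ->
    compact ((fun p : G * P => (act p.1 p.2, p.2)) @^-1` K).

Definition acts_by_automorphisms (omega : tensor2 P)
    (I : endomorphism_field P) (s : tensor2 P) :=
  forall g x u v,
    [/\ omega (act g x) (tangent_map (act g) x u) (tangent_map (act g) x v)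
          = omega x u v,
        tangent_map (act g) x (I x u) = I (act g x) (tangent_map (act g) x u) &
        s (act g x) (tangent_map (act g) x u) (tangent_map (act g) x v)
          = s x u v].

(* xi_P(x) *)
Definition inf_generator (xi : 'rV[R]_m) (x : P) : 'rV[R]_n :=
  tangent_map (fun g => act g x) (lone G) xi.

Definition momentum_map (omega : tensor2 P) (J : P -> 'cV[R]_m) :=
  smooth_fun J /\
  forall xi x v, omega x (inf_generator xi x) v =
    tangent_fun (fun x => pairing (J x) xi : R^o) x v.

(* J (g x) = Ad_(g^-1)^* (J x) *)
Definition equivariant_momentum (J : P -> 'cV[R]_m) :=
  forall g x xi, pairing (J (act g x)) xi = pairing (J x) (Ad (linv g) xi).

(* Q is the orbit space P/G with its smooth structure, the unique one for
   which the projection is a submersion; its dimension is dim P - dim G. *)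
Definition orbit_projection (Q : manifold R (n - m)) (pi : P -> Q) :=
  [/\ submersion pi, surjective_map pi &
      forall x x', pi x = pi x' <-> exists g, x' = act g x].

End Actions.

Section Forms.
Context {R : realType} {m n q : nat}.
Variables (P : manifold R n) (Q : manifold R q).
Variables (omega s : tensor2 P) (pi : P -> Q).
Variables (J : P -> 'cV[R]_m) (j : Q -> 'cV[R]_m).

Definition ortho (t : tensor2 P) (x : P) (S : set 'rV[R]_n) : set 'rV[R]_n :=
  [set v | forall w, S w -> t x v w = 0].

Definition hor (x : P) : set 'rV[R]_n :=
  ortho s x [set w | tangent_map pi x w = 0].

Definition ker_momentum (x : P) : set 'rV[R]_n :=
  [set v | tangent_fun J x v = 0].

Definition reconstruction_connection (x : P) : set 'rV[R]_n :=
  hor x `&` ker_momentum x.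

(* The sets T_x pi (A(x)^omega), x in the fiber of y, all coincide when omega,
   s and J are G-invariant. *)
Definition connectionD (y : Q) : set 'rV[R]_q :=
  \bigcup_(x in pi @^-1` [set y])
    tangent_map pi x @` ortho omega x (reconstruction_connection x).

Definition charE (y : Q) : set 'rV[R]_q := [set u | tangent_fun j y u = 0].

Definition proj_along (D E : set 'rV[R]_q) (u : 'rV[R]_q) : 'rV[R]_q :=
  xget 0 [set e | E e /\ D (u - e)].

(* In the next two definitions xget picks the common value of omega x u' v'
   over all admissible x, u', v'. *)
Definition omega_prime : tensor2 Q := fun y u v =>
  xget 0 [set r | exists x u' v',
    [/\ pi x = y, hor x u' /\ tangent_map pi x u' = u,
        hor x v' /\ tangent_map pi x v' = v & r = omega x u' v']].

(* The reduced form at y in P_mu, on T_y P_mu = Ker T_y j, determined by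
   (pi restricted to J^-1(mu))^* omega_mu = omega restricted to J^-1(mu),
   where T_x J^-1(mu) = Ker T_x J. *)
Definition omega_reduced (mu : 'cV[R]_m) (y : Q) (a b : 'rV[R]_q) : R :=
  xget 0 [set r | exists x u v,
    [/\ J x = mu /\ pi x = y, ker_momentum x u /\ tangent_map pi x u = a,
        ker_momentum x v /\ tangent_map pi x v = b & r = omega x u v]].

Definition omega_D : tensor2 Q := fun y u v =>
  omega_reduced (j y) y (proj_along (connectionD y) (charE y) u)
                        (proj_along (connectionD y) (charE y) v).

End Forms.

(* Main.v *)
From HB Require Import structures.
Require Import Defs.
From mathcomp Require Import all_boot all_order all_algebra.
From mathcomp Require Import all_classical all_reals all_analysis.
Import Order.TTheory GRing.Theory Num.Theory.
Import numFieldNormedType.Exports.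
Set Implicit Arguments.
Unset Strict Implicit.
Unset Printing Implicit Defensive.
Local Open Scope classical_set_scope.
Local Open Scope ring_scope.

(** Fix x in P and let K be the tangent space of the G-orbit at x. Writing I
    for the almost complex structure, the proof is linear algebra in T_x P,
    resting on four facts:

    - K = Ker T_x pi. Generators are tangent to the orbits, which pi collapses,
      and both sides have dimension m = dim G: the momentum map relation turns
      surjectivity of T_x J into injectivity of xi |-> xi_P(x)
      ([kernel_tangent_pi]).
    - Ker T_x J is the omega-complement of K, again by the momentum map relation
      ([ker_momentumE]).
    - K is isotropic, because J = j o pi is constant on orbits
      ([generator_isotropic]).
    - omega(v, w) = s(I v, w), so omega-complements are I-images of orthogonal
      complements.

    Hence I K is horizontal, and a horizontal vector splits as a + I k with k in
    K and a in the reconstruction connection A(x), the orthogonal complement of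
    K + I K ([horizontal_decomposition]). Moreover A(x)^omega = K + I K, so the
    fibre of D at pi(x) is T_x pi (I K) ([complementDE]), and the splitting
    a + I k of the horizontal lift of u projects to the splitting of u along
    E + D ([proj_along_reconstruction]). The form omega vanishes on A(x) x I K
    and on I K x I K, so omega on two horizontal lifts is omega on their
    A(x)-parts.
    These parts lie in Ker T_x J and project to the E-components, and there
    omega only depends on the projections since K is omega-orthogonal to
    Ker T_x J. This is the reduced form evaluated on p_D u and p_D v
    ([horizontal_values_eq]).

    The forms omega' and omega_D thus take the same values computed at any x
    over y, without comparing different x. Only D has to be compared along a
    fibre: G commutes with I and pi is G-invariant, so T_x pi (I K) is the same
    for all x over y ([connectionD_fiber]). *)

(** * Linear algebra of inner products *)

Section InnerProduct.
Context (R : realFieldType) (n : nat) (s : 'rV[R]_n -> 'rV[R]_n -> R).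
Hypothesis s_linear : forall u a (v v' : 'rV[R]_n),
  s u (a *: v + v') = a * s u v + s u v'.
Hypothesis s_sym : forall u v, s u v = s v u.
Hypothesis s_pos : forall v : 'rV[R]_n, v != 0 -> 0 < s v v.

Lemma innerDr u v v' : s u (v + v') = s u v + s u v'.
Proof. by rewrite -{1}(scale1r v) s_linear mul1r. Qed.

Lemma inner0r u : s u 0 = 0.
Proof.
have := innerDr u 0 0; rewrite addr0 => /esym/eqP.
by rewrite -subr_eq0 addrK => /eqP.
Qed.

Lemma innerZr u a v : s u (a *: v) = a * s u v.
Proof. by rewrite -[a *: v]addr0 s_linear inner0r addr0. Qed.

Lemma innerBr u v v' : s u (v - v') = s u v - s u v'.
Proof. by rewrite innerDr -scaleN1r innerZr mulN1r. Qed.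

Lemma innerDl u u' v : s (u + u') v = s u v + s u' v.
Proof. by rewrite s_sym innerDr !(s_sym v). Qed.

Lemma innerBl u u' v : s (u - u') v = s u v - s u' v.
Proof. by rewrite s_sym innerBr !(s_sym v). Qed.

Lemma inner_eq0 v : s v v = 0 -> v = 0.
Proof.
by move=> sv0; apply/eqP; apply: contraT => /s_pos; rewrite sv0 ltxx.
Qed.

Lemma inner_sumr u (k : nat) (c : 'rV[R]_k) (F : 'I_k -> 'rV[R]_n) :
  s u (\sum_i c 0 i *: F i) = \sum_i c 0 i * s u (F i).
Proof.
rewrite (big_morph (s u) (innerDr u) (inner0r u)).
by apply: eq_bigr => i _; rewrite innerZr.
Qed.

Lemma linear_rowE (k : nat) (f : {linear 'rV[R]_k -> 'rV[R]_n}) c :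
  f c = \sum_i c 0 i *: f (delta_mx 0 i).
Proof.
rewrite {1}[c]row_sum_delta linear_sum; apply: eq_bigr => i _.
by rewrite linearZ.
Qed.

(** The Gram matrix of the images of the basis vectors is invertible, since a
    vector in its kernel gives an f c orthogonal to itself; solving the normal
    equations with it yields the projection on the image of f. *)
Lemma orthogonal_projection (k : nat) (f : {linear 'rV[R]_k -> 'rV[R]_n}) :
  injective f -> forall v, exists c, forall d, s (v - f c) (f d) = 0.
Proof.
move=> f_inj v.
pose gram := \matrix_(i, j) s (f (delta_mx 0 i)) (f (delta_mx 0 j)).
pose coeffs u := \row_j s u (f (delta_mx 0 j)).
have coeffsP u d : s u (f d) = (d *m (coeffs u)^T) 0 0.
  rewrite (linear_rowE f d) inner_sumr mxE.
  by apply: eq_bigr => i _; rewrite !mxE.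
have gramP c : c *m gram = coeffs (f c).
  apply/rowP => j; rewrite !mxE s_sym (linear_rowE f c) inner_sumr.
  by apply: eq_bigr => i _; rewrite !mxE s_sym.
have gram_unit : gram \in unitmx.
  rewrite -row_free_unit; apply: inj_row_free => c; rewrite gramP => c0.
  apply: f_inj; rewrite linear0; apply: inner_eq0.
  by rewrite coeffsP c0 trmx0 mulmx0 mxE.
exists (coeffs v *m invmx gram) => d.
by rewrite innerBl !coeffsP -gramP -mulmxA mulVmx // mulmx1 subrr.
Qed.

End InnerProduct.

(** Injectivity of g forces m <= n, so the truncated difference n - m is the
    true one and Ker p has the dimension m of the image of g. *)
Lemma kernel_eq_image (F : fieldType) (m n : nat)
    (g : {linear 'rV[F]_m -> 'rV[F]_n})
    (p : {linear 'rV[F]_n -> 'rV[F]_(n - m)}) :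
  injective g -> surjective_map p -> (forall c, p (g c) = 0) ->
  forall v, p v = 0 <-> exists c, v = g c.
Proof.
move=> g_inj p_surj pg v; split=> [pv|[c ->]]; last exact: pg.
pose G := lin1_mx g; pose P := lin1_mx p.
have Gfree : row_free G.
  apply: inj_row_free => c; rewrite mul_rV_lin1 => gc0.
  by apply: g_inj; rewrite gc0 linear0.
have rG : \rank G = m by apply/eqP.
have Pfull : row_full P.
  rewrite -sub1mx; apply/row_subP => i.
  have [u pu] := p_surj (row i 1%:M).
  by rewrite -pu -mul_rV_lin1 submxMl.
have GP : (G <= kermx P)%MS.
  apply/sub_kermxP/row_matrixP => i.
  by rewrite row_mul row0 mul_rV_lin1 rowE mul_rV_lin1 pg.
have mn : (m <= n)%N by rewrite -rG rank_leq_col.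
have rK : \rank (kermx P) = m by rewrite mxrank_ker (eqP Pfull) subKn.
have KG : (kermx P <= G)%MS by rewrite -(mxrank_leqif_sup GP).2 rG rK.
have vK : (v <= kermx P)%MS by apply/sub_kermxP; rewrite mul_rV_lin1.
have /submxP[c ->] := submx_trans vK KG.
by exists c; rewrite mul_rV_lin1.
Qed.

(** * Reduction of a Hermitian vector space *)

Section HermitianReduction.
(* Here s, w, I, g and p stand for the metric, the symplectic form, the complex
   structure, xi |-> xi_P(x) and T_x pi at one point x. *)
Context (R : realType) (m n q : nat).
Context (s w : 'rV[R]_n -> 'rV[R]_n -> R) (I : {linear 'rV[R]_n -> 'rV[R]_n}).
Context (g : {linear 'rV[R]_m -> 'rV[R]_n}) (p : {linear 'rV[R]_n -> 'rV[R]_q}).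
Hypothesis s_linear : forall u a (v v' : 'rV[R]_n),
  s u (a *: v + v') = a * s u v + s u v'.
Hypothesis s_sym : forall u v, s u v = s v u.
Hypothesis s_pos : forall v : 'rV[R]_n, v != 0 -> 0 < s v v.
Hypothesis II : forall v, I (I v) = - v.
Hypothesis s_I : forall u v, s (I u) (I v) = s u v.
Hypothesis wE : forall u v, w u v = s (I u) v.
Hypothesis g_inj : injective g.
Hypothesis kerp : forall v, p v = 0 <-> exists c, v = g c.
Hypothesis isotropic : forall c d, w (g c) (g d) = 0.

Definition horizontal : set 'rV[R]_n :=
  [set v | forall k, p k = 0 -> s v k = 0].
(** The omega-complement of the orbit directions, which is the tangent space of
    the momentum level set. *)
Definition level : set 'rV[R]_n := [set v | forall c, w (g c) v = 0].
Definition reconstruction := horizontal `&` level.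
Definition complementD : set 'rV[R]_q :=
  p @` [set v | forall a, reconstruction a -> w v a = 0].

Lemma I_inj : injective I.
Proof. by move=> u v e; apply: oppr_inj; rewrite -!II e. Qed.

Lemma skew_I u v : s (I u) v = - s u (I v).
Proof.
by rewrite -[v in LHS]opprK -II s_I linearN -scaleN1r (innerZr s_linear) mulN1r.
Qed.

Lemma w_antisym u v : w u v = - w v u.
Proof. by rewrite !wE skew_I s_sym. Qed.

Lemma wBr u v v' : w u (v - v') = w u v - w u v'.
Proof. by rewrite !wE (innerBr s_linear). Qed.

Lemma wDr u v v' : w u (v + v') = w u v + w u v'.
Proof. by rewrite !wE (innerDr s_linear). Qed.

Lemma wDl u u' v : w (u + u') v = w u v + w u' v.
Proof. by rewrite !wE linearD (innerDl s_linear s_sym). Qed.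

Lemma p_g c : p (g c) = 0. Proof. by apply/kerp; exists c. Qed.

Lemma same_image u v : p u = p v -> exists c, u = v + g c.
Proof.
move=> e; have /kerp[c uv] : p (u - v) = 0 by rewrite linearB e subrr.
by exists c; rewrite -uv addrC subrK.
Qed.

Lemma horizontalP v : horizontal v <-> forall c, s v (g c) = 0.
Proof.
split=> [h c|h k /kerp[c ->]]; last exact: h.
by apply: h; apply: p_g.
Qed.

Lemma horizontal_Ig c : horizontal (I (g c)).
Proof. by apply/horizontalP => d; rewrite -wE isotropic. Qed.

Lemma horizontal_lift v : exists2 h, horizontal h & p h = p v.
Proof.
have [c hc] := orthogonal_projection s_linear s_sym s_pos g_inj v.
exists (v - g c); first exact/horizontalP.
by rewrite linearB /= p_g subr0.
Qed.

(** Project h orthogonally on I K. The remainder is still orthogonal to K, as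
    both h and I K are, and being orthogonal to I K is being omega-orthogonal to
    K. *)
Lemma horizontal_decomposition h : horizontal h ->
  exists a c, reconstruction a /\ h = a + I (g c).
Proof.
move=> hh.
have Ig_inj : injective (I \o g) by move=> c d /= /I_inj /g_inj.
have [c hc] := orthogonal_projection s_linear s_sym s_pos Ig_inj h.
exists (h - I (g c)), c; split; last by rewrite subrK.
split; last by move=> d; rewrite wE s_sym; apply: hc.
apply/horizontalP => d; rewrite (innerBl s_linear s_sym).
move/horizontalP: hh => ->; have /horizontalP -> := horizontal_Ig c.
by rewrite subrr.
Qed.

Lemma w_reconstruction_Ig a c : reconstruction a -> w a (I (g c)) = 0.
Proof. by move=> -[/horizontalP ha _]; rewrite wE s_I ha. Qed.

Lemma w_Ig_Ig c d : w (I (g c)) (I (g d)) = 0.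
Proof. by rewrite wE s_I -wE isotropic. Qed.

(** This is A^omega = K + I K seen through p, which kills K. For the nontrivial
    inclusion, if v is in A^omega then I v is orthogonal to A; splitting I v as
    a + I k' + k makes a orthogonal to itself. *)
Lemma complementDE : complementD = [set p (I (g c)) | c in setT].
Proof.
apply/seteqP; split=> [_ [v hv <-]|_ [c _ <-]]; last first.
  exists (I (g c)) => // a ha.
  by rewrite w_antisym w_reconstruction_Ig // oppr0.
have [c hc] := orthogonal_projection s_linear s_sym s_pos g_inj (I v).
have [a [d [ha e]]] := horizontal_decomposition (proj2 (horizontalP _) hc).
have Iv : I v = a + I (g d) + g c by rewrite -e subrK.
have a0 : a = 0.
  apply: (inner_eq0 s_pos); have := hv a ha.
  rewrite wE Iv !(innerDl s_linear s_sym) (s_sym (I _)) (s_sym (g c)).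
  have [/horizontalP /(_ c) -> /(_ d)] := ha.
  by rewrite wE s_sym => ->; rewrite !addr0.
exists (- c) => //.
have -> : v = g d + I (g (- c)).
  apply: oppr_inj; rewrite -II Iv a0 add0r linearD /= II !linearN /= opprD.
  by rewrite opprK.
by rewrite linearD /= p_g add0r.
Qed.

(** E and D meet trivially: a tangent vector of the level set lying in K + I K
    has its I K-part I k omega-orthogonal to k, and w k (I k) is the squared
    length of I k. *)
Lemma level_complementD a : level a -> complementD (p a) -> p a = 0.
Proof.
rewrite complementDE => la [c _ e].
have [d ed] := same_image (esym e).
have Ig0 : I (g c) = 0.
  apply: (inner_eq0 s_pos); rewrite -wE.
  have := la c; rewrite ed wDr isotropic addr0; apply.
by rewrite -e Ig0 linear0.
Qed.

Lemma proj_along_reconstruction (E : set 'rV[R]_q) a c :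
  (forall v, E (p v) <-> level v) -> reconstruction a ->
  proj_along complementD E (p (a + I (g c))) = p a.
Proof.
move=> hE [_ la]; apply: xget_unique.
  split; first exact/hE.
  by rewrite linearD addrC addKr complementDE; exists c.
rewrite complementDE => e [Ee [d _ De]].
have eE : e = p (a + I (g (c - d))).
  by rewrite !linearB /= addrA linearB /= De subKr.
have lb := (hE _).1 (eq_ind _ E Ee _ eE).
have lba : level (I (g (c - d))).
  by move=> k; rewrite -[I _](addKr a) addrC wBr lb la subrr.
rewrite eE (linearD p) /= (level_complementD lba) ?addr0 // complementDE.
by exists (c - d).
Qed.

(** The form w vanishes on A x I K and I K x I K, so on horizontal lifts it only
    sees the A-parts; on level vectors it only sees the image under p. Both
    sides thus describe the same number r. *)
Lemma horizontal_values_eq (E : set 'rV[R]_q) u v r :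
  (forall v, E (p v) <-> level v) ->
  (exists u0, p u0 = u) -> (exists v0, p v0 = v) ->
  (exists u' v', [/\ horizontal u' /\ p u' = u, horizontal v' /\ p v' = v &
     r = w u' v']) <->
  (exists u' v', [/\ level u' /\ p u' = proj_along complementD E u,
     level v' /\ p v' = proj_along complementD E v & r = w u' v']).
Proof.
move=> hE [u0 <-] [v0 <-].
have w_horizontal a b c d : reconstruction a -> reconstruction b ->
    w (a + I (g c)) (b + I (g d)) = w a b.
  move=> ha hb; rewrite wDl !wDr w_reconstruction_Ig // w_Ig_Ig.
  by rewrite (w_antisym (I _)) w_reconstruction_Ig // oppr0 !addr0.
split=> [[u' [v' [[hu pu] [hv pv] ->]]]|[u' [v' [[lu pu] [lv pv] ->]]]].
  have [a [c [ha eu]]] := horizontal_decomposition hu.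
  have [b [d [hb ev]]] := horizontal_decomposition hv.
  exists a, b; rewrite -pu -pv eu ev w_horizontal //.
  rewrite !(proj_along_reconstruction _ hE) //.
  by case: ha hb => _ ? [].
(* The given lifts u', v' in the level set need not be horizontal; they differ
   from the A-parts of the horizontal lifts by orbit directions. *)
have [hu Hu e_u] := horizontal_lift u0; have [hv Hv e_v] := horizontal_lift v0.
have [a [c [ha eu]]] := horizontal_decomposition Hu.
have [b [d [hb ev]]] := horizontal_decomposition Hv.
exists hu, hv; split=> //; rewrite eu ev w_horizontal //.
move: pu pv; rewrite -e_u -e_v eu ev !(proj_along_reconstruction _ hE) //.
move=> /same_image[k ->] /same_image[l lE].
case: hb => _ hb; rewrite wDl lv addr0 lE wDr.
by rewrite (w_antisym a (g l)) ha.2 oppr0 addr0.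
Qed.

End HermitianReduction.

(** * Tangent maps and the chain rule *)

Section Differentials.
Context {R : realType}.

Definition differentiable_at_point (m : nat) (W : normedModType R)
    (M : manifold R m) (f : M -> W) (x : M) :=
  differentiable (f \o cinv (chart_at x)) (cmap (chart_at x) x).

Lemma chart_at_img (m : nat) (M : manifold R m) (x : M) :
  cimg (chart_at x) (cmap (chart_at x) x).
Proof. exact/cmap_img/chart_at_dom. Qed.

Lemma chart_atK (m : nat) (M : manifold R m) (x : M) :
  cinv (chart_at x) (cmap (chart_at x) x) = x.
Proof. exact/cmapK/chart_at_dom. Qed.

Lemma smooth_fun_differentiable (m : nat) (W : normedModType R)
    (M : manifold R m) (f : M -> W) (x : M) :
  smooth_fun f -> differentiable_at_point f x.
Proof.
by move=> /(_ _ (chart_at_atlas x) 1%N) [+ _]; apply; exact: chart_at_img.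
Qed.

Lemma smooth_map_differentiable (m n : nat) (M : manifold R m)
    (N : manifold R n) (f : M -> N) (x : M) :
  smooth_map f -> differentiable_at_point (cmap (chart_at (f x)) \o f) x.
Proof.
move=> [_ /(_ _ _ (chart_at_atlas x) (chart_at_atlas (f x)) 1%N) [+ _]]; apply.
by split; [exact: chart_at_img|rewrite /= chart_atK; exact: chart_at_dom].
Qed.

(** The local representatives satisfy the chain rule only up to a transition
    through the chart at f x, valid near x; equality of germs suffices because
    differentials are read off directional derivatives. *)
Lemma tangent_fun_comp (m n : nat) (W : normedModType R) (M : manifold R m)
    (N : manifold R n) (f : M -> N) (h : N -> W) (x : M) v :
  {for x, continuous f} ->
  differentiable_at_point (cmap (chart_at (f x)) \o f) x ->
  differentiable_at_point h (f x) ->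
  differentiable_at_point (h \o f) x ->
  tangent_fun (h \o f) x v = tangent_fun h (f x) (tangent_map f x v).
Proof.
rewrite /differentiable_at_point /tangent_fun /tangent_map.
set c := chart_at x; set d := chart_at (f x); set a := cmap c x => fx df dh dhf.
have dh' : differentiable (h \o cinv d) ((cmap d \o f \o cinv c) a).
  by rewrite /= chart_atK.
have -> : cmap d (f x) = (cmap d \o f \o cinv c) a by rewrite /= chart_atK.
transitivity ('d ((h \o cinv d) \o (cmap d \o f \o cinv c)) a v); last first.
  by rewrite diff_comp.
have dhf' := differentiable_comp df dh'.
rewrite -(deriveE v dhf) -(deriveE v dhf').
apply: near_eq_derive.
have cvg_fc : f \o cinv c @ a --> f x.
  rewrite -[x in f x](chart_atK x); apply: continuous_comp.
    exact: (@cinv_continuous _ _ _ c a (chart_at_img x)).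
  by rewrite /= chart_atK.
have nd : \forall y \near f x, cdom d y.
  exact: (open_nbhs_nbhs (conj (cdom_open d) (chart_at_dom (f x)))).
have nd' : \forall y \near a, cdom d (f (cinv c y)) := cvg_fc _ nd.
near=> y; rewrite /= cmapK //; near: y; exact: nd'.
Unshelve. all: by end_near.
Qed.

Lemma tangent_map_comp (m n k : nat) (M : manifold R m)
    (N : manifold R n) (L : manifold R k) (f : M -> N) (h : N -> L) (x : M) v :
  {for x, continuous f} ->
  differentiable_at_point (cmap (chart_at (f x)) \o f) x ->
  smooth_map h ->
  differentiable_at_point (cmap (chart_at (h (f x))) \o (h \o f)) x ->
  tangent_map (h \o f) x v = tangent_map h (f x) (tangent_map f x v).
Proof.
move=> cf df sh dhf.
apply: (tangent_fun_comp (h := cmap (chart_at (h (f x))) \o h)) => //.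
exact: smooth_map_differentiable.
Qed.

Section Joint.
Context (m n k : nat) (M : manifold R m) (N : manifold R n) (L : manifold R k).
Context (f : M -> N -> L).
Hypothesis f_smooth : smooth_map2 f.

Lemma smooth_map2_continuousl y : continuous (f ^~ y).
Proof.
move=> x.
apply: (@continuous_comp _ _ _ (fun z => (z, y)) (fun p => f p.1 p.2)).
  by apply: cvg_pair => /=; [exact: cvg_id|exact: cvg_cst].
exact: f_smooth.1.
Qed.

Lemma smooth_map2_continuousr x : continuous (f x).
Proof.
move=> y.
apply: (@continuous_comp _ _ _ (fun z => (x, z)) (fun p => f p.1 p.2)).
  by apply: cvg_pair => /=; [exact: cvg_cst|exact: cvg_id].
exact: f_smooth.1.
Qed.

Lemma smooth_map2_differentiable x y :
  let c := chart_at x in let d := chart_at y in let e := chart_at (f x y) in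
  differentiable (fun p : 'rV[R]_m * 'rV[R]_n =>
    cmap e (f (cinv c p.1) (cinv d p.2))) (cmap c x, cmap d y).
Proof.
move=> c d e; have [_ sf] := f_smooth.
have [+ _] := sf _ _ _ (chart_at_atlas x) (chart_at_atlas y)
  (chart_at_atlas (f x y)) 1%N.
apply; split=> /=; [exact: chart_at_img|exact: chart_at_img|].
by rewrite !chart_atK; exact: chart_at_dom.
Qed.

Lemma smooth_map2_differentiablel x y :
  differentiable_at_point (cmap (chart_at (f x y)) \o f ^~ y) x.
Proof.
have df := smooth_map2_differentiable x y.
rewrite /differentiable_at_point.
have -> : (cmap (chart_at (f x y)) \o f ^~ y) \o cinv (chart_at x) =
    (fun p : 'rV[R]_m * 'rV[R]_n => cmap (chart_at (f x y))
      (f (cinv (chart_at x) p.1) (cinv (chart_at y) p.2))) \o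
    (fun a => (a, cmap (chart_at y) y)).
  by apply/funext => a /=; rewrite chart_atK.
apply: differentiable_comp; last exact: df.
exact: differentiable_pair.
Qed.

Lemma smooth_map2_differentiabler x y :
  differentiable_at_point (cmap (chart_at (f x y)) \o f x) y.
Proof.
have df := smooth_map2_differentiable x y.
rewrite /differentiable_at_point.
have -> : (cmap (chart_at (f x y)) \o f x) \o cinv (chart_at y) =
    (fun p : 'rV[R]_m * 'rV[R]_n => cmap (chart_at (f x y))
      (f (cinv (chart_at x) p.1) (cinv (chart_at y) p.2))) \o
    (fun a => (cmap (chart_at x) x, a)).
  by apply/funext => a /=; rewrite chart_atK.
apply: differentiable_comp; last exact: df.
exact: differentiable_pair.
Qed.

End Joint.

Lemma pairing_linear (m : nat) (xi : 'rV[R]_m) :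
  linear (fun mu : 'cV[R]_m => pairing mu xi : R^o).
Proof. by move=> a u v; rewrite /pairing mulmxDr -scalemxAr !mxE. Qed.

Lemma pairing_continuous (m : nat) (xi : 'rV[R]_m) :
  continuous (fun mu : 'cV[R]_m => pairing mu xi : R^o).
Proof.
have -> : (fun mu : 'cV[R]_m => pairing mu xi : R^o) =
    \sum_(i < m) (xi 0 i *: (fun mu : 'cV[R]_m => mu i 0 : R^o)).
  by apply/funext => mu; rewrite /pairing mxE fct_sumE.
move=> mu; apply: differentiable_continuous; apply: differentiable_sum => i.
apply: differentiableZ; exact: differentiable_coord.
Qed.

Lemma tangent_fun_pairing (m n : nat) (M : manifold R n) (J : M -> 'cV[R]_m)
    xi x v : smooth_fun J ->
  tangent_fun (fun x => pairing (J x) xi : R^o) x v =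
  pairing (tangent_fun J x v) xi.
Proof.
move=> sJ; pose l : {linear 'cV[R]_m -> R^o} :=
  HB.pack (fun mu : 'cV[R]_m => pairing mu xi : R^o)
    (GRing.isLinear.Build _ _ _ _ _ (pairing_linear xi)).
have lc : continuous l := @pairing_continuous m xi.
have := smooth_fun_differentiable x sJ.
rewrite /differentiable_at_point /tangent_fun => dJ.
have dl : differentiable l ((J \o cinv (chart_at x)) (cmap (chart_at x) x)).
  exact: linear_differentiable.
transitivity ('d (l \o (J \o cinv (chart_at x))) (cmap (chart_at x) x) v) => //.
by rewrite diff_comp // diff_lin.
Qed.

End Differentials.

(** * Reduction of an almost Kaehler manifold *)

(** The tangent map with its linear structure kept in the type. *)
Definition tangent_linear (R : realType) (m n : nat) (M : manifold R m)
    (N : manifold R n) (f : M -> N) (x : M) : {linear 'rV[R]_m -> 'rV[R]_n} :=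
  'd (cmap (chart_at (f x)) \o f \o cinv (chart_at x)) (cmap (chart_at x) x).

Section Reduction.
Context (R : realType) (n m : nat).
Context (P : manifold R n) (omega : tensor2 P) (I : endomorphism_field P)
  (s : tensor2 P) (hP : almost_kahler omega I s).
Context (G : lie_group R m) (act : G -> P -> P) (hact : smooth_action act)
  (haut : acts_by_automorphisms act omega I s).
Context (J : P -> 'cV[R]_m) (hJ : momentum_map act omega J)
  (hJsub : submersion_fun J).
Context (Q : manifold R (n - m)) (pi : P -> Q) (hpi : orbit_projection act pi).
Context (j : Q -> 'cV[R]_m) (hj : submersion_fun j)
  (hjpi : forall x : P, J x = j (pi x)).

Local Notation gen := (fun x => tangent_linear (act^~ x) (lone G)).
Local Notation Tpi := (tangent_linear pi).

Lemma act1 x : act (lone G) x = x. Proof. by case: hact. Qed.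

Lemma pi_act g x : pi (act g x) = pi x.
Proof. by have [_ _ hf] := hpi; apply/esym/hf; exists g. Qed.

Lemma pi_smooth : smooth_map pi. Proof. by case: hpi => -[]. Qed.

Lemma act_smooth : smooth_map2 act. Proof. by case: hact. Qed.

(** pi is constant on the orbit map g |-> g x. The generator is a tangent vector
    at act 1 x, which equals x only propositionally. *)
Lemma tangent_pi_generator x c : Tpi x (gen x c) = 0.
Proof.
have pi_orbit : pi \o act^~ x = cst (pi x).
  by apply/funext => g /=; rewrite pi_act.
have comp : tangent_map (pi \o act^~ x) (lone G) c =
    tangent_map pi (act (lone G) x) (tangent_map (act^~ x) (lone G) c).
  apply: tangent_map_comp.
  - exact: smooth_map2_continuousl act_smooth _ _.
  - exact: smooth_map2_differentiablel act_smooth _ _.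
  - exact: pi_smooth.
  - rewrite pi_orbit.
    exact: (differentiable_cst (cmap (chart_at (pi (act (lone G) x))) (pi x))).
have const : tangent_map (pi \o act^~ x) (lone G) c = 0.
  rewrite pi_orbit /tangent_map.
  by rewrite -[X in 'd X _]/(cst (cmap _ (pi x))) diff_cst.
by move: comp; rewrite const act1.
Qed.

Lemma tangent_pi_act g x v :
  Tpi (act g x) (tangent_map (act g) x v) = Tpi x v.
Proof.
have pi_g : pi \o act g = pi by apply/funext => y /=; rewrite pi_act.
have : tangent_map (pi \o act g) x v =
    tangent_map pi (act g x) (tangent_map (act g) x v).
  apply: tangent_map_comp.
  - exact: smooth_map2_continuousr act_smooth _ _.
  - exact: smooth_map2_differentiabler act_smooth _ _.
  - exact: pi_smooth.
  - by rewrite pi_g pi_act; exact: smooth_map_differentiable pi_smooth.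
by rewrite pi_g.
Qed.

Lemma tangent_momentum x v : tangent_fun J x v = tangent_fun j (pi x) (Tpi x v).
Proof.
have JE : J = j \o pi by apply/funext => y /=; rewrite hjpi.
have dJ := smooth_fun_differentiable x hJsub.1.
rewrite {1}JE; apply: tangent_fun_comp.
- exact: pi_smooth.1.
- exact: smooth_map_differentiable pi_smooth.
- exact: smooth_fun_differentiable hj.1.
- by rewrite -JE.
Qed.

Lemma omega_generator x c v :
  omega x (gen x c) v = pairing (tangent_fun J x v) c.
Proof. by rewrite -tangent_fun_pairing; [exact: hJ.2|exact: hJ.1]. Qed.

(** A generator determines the pairings of xi with all values of T_x J, and
    these fill the dual of the Lie algebra. *)
Lemma generator_injective x : injective (gen x).
Proof.
move=> c d e; apply/rowP => i.
have [v Jv] := hJsub.2 x (delta_mx i 0).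
have := omega_generator x c v; rewrite e omega_generator Jv /pairing.
by rewrite -!colE !mxE.
Qed.

Lemma tangent_pi_surjective x : surjective_map (Tpi x).
Proof. by have [[_ +] _ _] := hpi; apply. Qed.

Lemma kernel_tangent_pi x v : Tpi x v = 0 <-> exists c, v = gen x c.
Proof.
apply: kernel_eq_image; first exact: generator_injective.
  exact: tangent_pi_surjective.
exact: tangent_pi_generator.
Qed.

(** omega (xi_P, eta_P) is the derivative of <J, xi> along an orbit, on which
    J = j o pi is constant. *)
Lemma generator_isotropic x c d : omega x (gen x c) (gen x d) = 0.
Proof.
rewrite omega_generator tangent_momentum tangent_pi_generator.
by rewrite /tangent_fun linear0 /pairing mulmx0 mxE.
Qed.

Lemma ker_momentumE x : ker_momentum J x = level (omega x) (gen x).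
Proof.
apply/seteqP; split=> v; rewrite /ker_momentum /level /=.
  by move=> Jv c; rewrite omega_generator Jv /pairing mulmx0 mxE.
move=> h; apply/colP => i.
by have := h (delta_mx 0 i); rewrite omega_generator /pairing -rowE !mxE.
Qed.

Lemma charE_tangent_pi x v :
  charE j (pi x) (Tpi x v) <-> level (omega x) (gen x) v.
Proof. by rewrite -ker_momentumE /charE /ker_momentum /= tangent_momentum. Qed.

Lemma I_linear x : linear (I x).
Proof. by case: hP => _ [+ _ _]. Qed.

Definition Ilin x : {linear 'rV[R]_n -> 'rV[R]_n} :=
  HB.pack (I x) (GRing.isLinear.Build _ _ _ _ _ (I_linear x)).

Lemma s_linear x u a (v v' : 'rV[R]_n) :
  s x u (a *: v + v') = a * s x u v + s x u v'.
Proof. by have [_ _ [[_ [+ _]] _ _] _ _] := hP; apply. Qed.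

Lemma s_sym x u v : s x u v = s x v u.
Proof. by have [_ _ [_ + _] _ _] := hP; apply. Qed.

Lemma s_pos x (v : 'rV[R]_n) : v != 0 -> 0 < s x v v.
Proof. by have [_ _ [_ _ +] _ _] := hP; apply. Qed.

Lemma II x v : Ilin x (Ilin x v) = - v.
Proof. by have [_ [_ _ +] _ _ _] := hP; apply. Qed.

Lemma s_I x u v : s x (Ilin x u) (Ilin x v) = s x u v.
Proof. by have [_ _ _ + _] := hP; apply. Qed.

Lemma omegaE x u v : omega x u v = s x (Ilin x u) v.
Proof. by have [_ _ _ _ +] := hP; apply. Qed.

Lemma fiber_complementE x :
  Tpi x @` Defs.ortho omega x (reconstruction_connection s pi J x) =
  [set Tpi x (I x (gen x c)) | c in setT].
Proof.
have := complementDE (@s_linear x) (@s_sym x) (@s_pos x) (@II x) (@s_I x)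
  (@omegaE x) (@generator_injective x) (@kernel_tangent_pi x)
  (@generator_isotropic x).
by rewrite /complementD /reconstruction -ker_momentumE.
Qed.

(** Two points over the same orbit are related by some g, and T g carries I K to
    I K: it commutes with I and maps Ker T pi to Ker T pi. *)
Lemma connectionD_fiber x :
  connectionD omega s pi J (pi x) =
  complementD (s x) (omega x) (gen x) (Tpi x).
Proof.
have -> : complementD (s x) (omega x) (gen x) (Tpi x) =
    Tpi x @` Defs.ortho omega x (reconstruction_connection s pi J x).
  by rewrite /complementD /reconstruction -ker_momentumE.
apply/seteqP; split=> [u [x' /= px' Du]|u Du]; last by exists x.
have [c _ <-] : [set Tpi x' (I x' (gen x' c)) | c in setT] u.
  by rewrite -fiber_complementE.
suff : [set Tpi x (I x (gen x d)) | d in setT] (Tpi x' (I x' (gen x' c))).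
  by rewrite -fiber_complementE.
have [_ _ orbits] := hpi; have [g ->] := (orbits x' x).1 px'.
have [|d dE] :=
  (kernel_tangent_pi (act g x') (tangent_map (act g) x' (gen x' c))).1.
  by rewrite tangent_pi_act tangent_pi_generator.
exists d => //.
have [_ IE _] := haut g x' (gen x' c) 0.
rewrite -[RHS](tangent_pi_act g) IE; congr (Tpi _ (I _ _)).
exact: esym dE.
Qed.

Lemma omega_prime_eq_D : omega_prime omega s pi = omega_D omega s pi J j.
Proof.
apply/funext => y; apply/funext => u; apply/funext => v.
rewrite /omega_D /omega_reduced /omega_prime; congr xget.
have values x r := horizontal_values_eq (@s_linear x) (@s_sym x) (@s_pos x)
  (@II x) (@s_I x) (@omegaE x) (@generator_injective x) (@kernel_tangent_pi x)
  (@generator_isotropic x) r (@charE_tangent_pi x)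
  (tangent_pi_surjective x u) (tangent_pi_surjective x v).
apply/seteqP; split=> r [x].
  move=> [u' [v' [px hu hv rE]]]; subst y; exists x.
  have [|a [b [ha hb ->]]] := (values x r).1; first by exists u', v'.
  by exists a, b; rewrite hjpi ker_momentumE connectionD_fiber.
move=> [a [b [[_ px] ha hb rE]]]; subst y; exists x.
have [|u' [v' [hu hv ->]]] := (values x r).2; last by exists u', v'.
by exists a, b; rewrite -connectionD_fiber -ker_momentumE.
Qed.

End Reduction.

Theorem theorem4p14 (R : realType) (n m : nat)
  (P : manifold R n) (omega : tensor2 P) (I : endomorphism_field P)
  (s : tensor2 P) (hP : almost_kahler omega I s)
  (G : lie_group R m) (hG : abelian_lie_group G)
  (act : G -> P -> P) (hact : smooth_action act)
  (hfree : free_action act) (hproper : proper_action act)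
  (haut : acts_by_automorphisms act omega I s)
  (J : P -> 'cV[R]_m) (hJ : momentum_map act omega J)
  (hJeq : equivariant_momentum act J) (hJsub : submersion_fun J)
  (Q : manifold R (n - m)) (pi : P -> Q) (hpi : orbit_projection act pi)
  (j : Q -> 'cV[R]_m) (hj : submersion_fun j)
  (hjpi : forall x : P, J x = j (pi x))
  (hconn : forall mu : 'cV[R]_m, range J mu ->
     connected (j @^-1` [set mu])) :
  omega_prime omega s pi = omega_D omega s pi J j.
Proof.
exact: (omega_prime_eq_D hP hact haut hJ hJsub hpi hj hjpi).
Qed.
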